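(* Let $n\ge 5$ and let $L_1,L_2\colon\mathbb{F}_{2^n}\to\mathbb{F}_{2^n}$ be non-zero, non-bijective linear maps, and let $F(x)=L_1(x^{-1})+L_2(x)$. Let $d=\frac{n-2}{2}$ if $n\equiv 0,2,4,6\pmod 8$, $d=\frac{n-1}{2}$ if $n\equiv 1,7\pmod 8$, and $d=\frac{n-3}{2}$ if $n\equiv 3,5\pmod 8$. If $\max(\dim\ker L_1,\dim\ker L_2)>d$, then $F$ is not a permutation of $\mathbb{F}_{2^n}$.
   Context: ''Linear'' means $\mathbb{F}_2$-linear, and kernels' dimensions are over $\mathbb{F}_2$. The convention $0^{-1}=0$ is used. *)

(* Defs.v *)
From HB Require Import structures.
From mathcomp Require Import all_boot all_algebra all_field.

Set Implicit Arguments.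
Unset Strict Implicit.
Unset Printing Implicit Defensive.

Import GRing.Theory.
Local Open Scope ring_scope.

(* The subtractions do not truncate for n >= 2 (resp. 3), and each division
   is exact in the branch where it occurs. *)
Definition kerdim_bound (n : nat) : nat :=
  if (n %% 8)%N \in [:: 0; 2; 4; 6]%N then ((n - 2) %/ 2)%N
  else if (n %% 8)%N \in [:: 1; 7]%N then ((n - 1) %/ 2)%N
  else ((n - 3) %/ 2)%N.

(* MathComp's inverse satisfies 0^-1 = 0, so this is total with the intended
   convention. *)
Definition inv_plus_lin (L : fieldExtType 'F_2) (L1 L2 : 'End(L)) (x : L) : L :=
  L1 x^-1 + L2 x.

(* Main.v *)
From HB Require Import structures.
Require Import Defs.
From mathcomp Require Import all_boot all_algebra all_field zify ring.

Import GRing.Theory.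
Local Open Scope ring_scope.

(* Write tr for the absolute trace, M1 and M2 for the adjoints of L1 and L2 with
   respect to tr(x y), and let n be the degree.  Replacing x by x^-1 if needed,
   assume that L2 has the large kernel.  Put A = M1 (ker M2) and B = im M2; if F
   is bijective then dim A = dim ker L2 and dim A + dim B = n.

   Since F is bijective and n > 3, the sum over x of
   tr(u F(x)) tr(v F(x)) tr(b F(x)) vanishes.  For u, v in ker M2 the first two
   factors depend on x^-1 only, and evaluating power sums turns the identity into
   tr(q^2 a a') = 0 for all q in B and a, a' in A.  The case a = a' gives
   tr(q a) = 0, so B is the orthogonal of A, and then q^2 a lies in B for all q
   in B and a in A.  In particular dim A <= dim B, so a large kernel leaves only
   dim B = dim A + 1 or dim B = dim A.

   By counting, B = {q^2 a : q in B} for each nonzero a in A, so B is stable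
   under the ratios of elements of A.  If dim B = dim A + 1 then dim B and n are
   coprime, B is not a space over any proper extension of F_2, and dim A <= 1.

   If dim B = dim A, choose b0 <> 0 with M1 b0 = 0, and c = M2 b0.  Then
   B = c^2 A, which forces c A to be closed under powers, and so a^-1 to lie in B
   for all a in A.  Hence F maps A into the orthogonal of ker M2 + <b0>, whose
   dimension is only dim A - 1. *)

(** * Characteristic 2 and power sums over the field *)

Lemma pchar2 (L : fieldExtType 'F_2) : 2 \in [pchar L].
Proof. by rewrite (GRing.pchar_lalg L) pchar_Fp. Qed.

Lemma addxx {L : fieldExtType 'F_2} (x : L) : x + x = 0.
Proof. exact: addrr_pchar2 (pchar2 L) x. Qed.

Lemma expr2nD {L : fieldExtType 'F_2} (i : nat) :
  {morph (fun x : L => x ^+ (2 ^ i)) : x y / x + y}.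
Proof.
move=> x y; apply: exprDn_pchar; rewrite pnatX pnatE //.
by rewrite pchar2.
Qed.

Lemma expr2n_dim {L : fieldExtType 'F_2} (x : L) : x ^+ (2 ^ \dim {:L}) = x.
Proof.
apply/eqP; move: (Fermat's_little_theorem {:L}%AS x).
by rewrite memvf card_Fp.
Qed.

Lemma card_finvect (L : fieldExtType 'F_2) :
  #|{: finvect_type L}| = (2 ^ \dim {:L})%N.
Proof. by have := card_vspace {: finvect_type L}%VS; rewrite card_vspacef card_Fp.
Qed.

Lemma dimf_gt0 (L : fieldExtType 'F_2) : (0 < \dim {:L})%N.
Proof. exact: adim_gt0. Qed.

Lemma exp2_gt1_dim (L : fieldExtType 'F_2) : (1 < 2 ^ \dim {:L})%N.
Proof. by rewrite -{1}(expn0 2) ltn_exp2l // dimf_gt0. Qed.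

(** X^(e+1) - X has fewer roots than the field has elements, so y^e <> 1 for some nonzero y;
    substituting y x for x multiplies the sum by y^e. *)
Lemma sum_expr_lt {L : fieldExtType 'F_2} (e : nat) :
  (0 < e < (2 ^ \dim {:L}).-1)%N -> \sum_(x : finvect_type L) (x : L) ^+ e = 0.
Proof.
case/andP=> e0 eN.
have [y y0 ye]: exists2 y : L, y != 0 & y ^+ e != 1.
  pose p : {poly L} := 'X^(e.+1) - 'X.
  have sp : size p = e.+2.
    by rewrite size_polyDl size_polyXn // size_polyN size_polyX ltnS.
  have: ~~ all (root p) (enum (finvect_type L)).
    apply/negP=> rp; pose s : seq L := enum (finvect_type L).
    have ss : size s = (2 ^ \dim {:L})%N by rewrite -card_finvect cardE.
    have p0 : p != 0 by rewrite -size_poly_eq0 sp.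
    have := max_poly_roots (rs := s) p0 rp (enum_uniq _); rewrite sp ss.
    by rewrite ltnNge -ltn_predRL eN.
  case/allPn=> y _; rewrite rootE /p !hornerE => yp; exists y.
    by apply: contraNneq yp => ->; rewrite exprS mul0r subrr.
  by apply: contraNneq yp => ye; rewrite exprS ye mulr1 subrr.
apply: (mulfI (x := y ^+ e - 1)); first by rewrite subr_eq0.
rewrite mulr0 mulrBl mul1r mulr_sumr.
have yI : injective ( *%R y : finvect_type L -> finvect_type L) by exact: mulfI.
rewrite [X in _ - X](reindex_inj yI) -sumrB big1 // => x _.
by rewrite exprMn subrr.
Qed.

Lemma sum_expr_max (L : fieldExtType 'F_2) :
  \sum_(x : finvect_type L) (x : L) ^+ (2 ^ \dim {:L}).-1 = 1.
Proof.
have N0 := exp2_gt1_dim L.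
(* The exponent is positive, so the term at 0 vanishes; the other terms are 1 and their number is
   odd. *)
rewrite (bigD1 (0 : finvect_type L)) //= expr0n -subn1 subn_eq0 leqNgt N0 add0r.
rewrite (eq_bigr (fun=> 1)) => [|x x0]; last first.
  apply: (mulfI (x := x : L)) => //.
  by rewrite mulr1 -exprS subn1 prednK ?expr2n_dim // ltnW.
rewrite sumr_const cardC1 card_finvect.
have : (1 : L) *+ (2 ^ \dim {:L}).-1 + 1 = 0.
  by rewrite -mulrSr prednK ?(ltnW N0) // -(prednK (dimf_gt0 L))
     expnS mulrnA -[1 *+ 2]/(1 + 1) addxx mul0rn.
by move/eqP; rewrite addr_eq0 (oppr_pchar2 (pchar2 L)) => /eqP.
Qed.

(** * The absolute trace *)

(** Its values are kept in [L], so that products of traces expand into power sums. *)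
Definition trace2 {L : fieldExtType 'F_2} (x : L) : L :=
  \sum_(i < \dim {:L}) x ^+ (2 ^ i).

Lemma trace2D {L : fieldExtType 'F_2} (x y : L) :
  trace2 (x + y) = trace2 x + trace2 y.
Proof. by rewrite -big_split; apply: eq_bigr => i _; rewrite expr2nD. Qed.

Lemma trace2_0 {L : fieldExtType 'F_2} : trace2 (0 : L) = 0.
Proof. by apply: (addIr (trace2 0)); rewrite -trace2D !add0r. Qed.

Lemma trace2_sqr {L : fieldExtType 'F_2} (x : L) : trace2 (x ^+ 2) = trace2 x.
Proof.
rewrite /trace2; case: (\dim _) (expr2n_dim x) (dimf_gt0 L) => // n xn _.
rewrite big_ord_recr big_ord_recl /= expr1 addrC -exprM -expnS xn; congr (_ + _).
by apply: eq_bigr => i _; rewrite -exprM -expnS.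
Qed.

Lemma sqr_trace2 {L : fieldExtType 'F_2} (x : L) : trace2 x ^+ 2 = trace2 x.
Proof.
rewrite -[RHS]trace2_sqr /trace2.
elim/big_rec2: _ => [|i u v _ <-]; first by rewrite expr0n.
by rewrite (expr2nD 1) -!exprM mulnC.
Qed.

Lemma trace2_expr2n {L : fieldExtType 'F_2} (x : L) (i : nat) :
  trace2 x ^+ (2 ^ i) = trace2 x.
Proof. by elim: i => // i IH; rewrite expnS exprM sqr_trace2. Qed.

Lemma trace2_eq {L : fieldExtType 'F_2} (x : L) : trace2 x != 0 -> trace2 x = 1.
Proof.
by move=> t0; apply: (mulfI t0); rewrite mulr1 -expr2 sqr_trace2.
Qed.

Lemma trace2_sum {L : fieldExtType 'F_2} [I : Type] (r : seq I) (f : I -> L) :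
  trace2 (\sum_(i <- r) f i) = \sum_(i <- r) trace2 (f i).
Proof.
exact: (big_morph (@trace2 L) trace2D trace2_0).
Qed.

Lemma trace2_mul_trace2 {L : fieldExtType 'F_2} (x y : L) :
  trace2 (trace2 x * y) = trace2 x * trace2 y.
Proof.
by rewrite mulr_sumr; apply: eq_bigr => i _; rewrite exprMn trace2_expr2n.
Qed.

Lemma trace2Z {L : fieldExtType 'F_2} (k : 'F_2) (x : L) :
  trace2 (k *: x) = k *: trace2 x.
Proof.
rewrite /trace2 scaler_sumr; apply: eq_bigr => i _; rewrite exprZn.
congr (_ *: _); elim: (i : nat) => // j IH.
rewrite expnS exprM.
by have := expf_card k; rewrite card_Fp // => ->.
Qed.

(* Expanding both traces leaves the power sums of exponents [2^i + 2^j - 1],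
   of which only [i = j = n - 1] contributes. *)
Lemma sum_trace2_inv {L : fieldExtType 'F_2} (a b : L) :
  \sum_(x : finvect_type L) trace2 (a * x : L) * trace2 (b * x : L) * (x : L)^-1
  = (a * b) ^+ (2 ^ (\dim {:L}).-1).
Proof.
have n0 := dimf_gt0 L; set n := \dim _ in n0 *.
have ltn1 : (n.-1 < n)%N by rewrite prednK.
pose e (i j : nat) := ((2 ^ i + 2 ^ j).-1)%N.
have e0 (i j : nat) : (0 < e i j)%N.
  by rewrite /e ltn_predRL (@leq_add 1 1) ?expn_gt0.
have eS (i j : nat) : (e i j).+1 = (2 ^ i + 2 ^ j)%N.
  by rewrite prednK // addn_gt0 expn_gt0.
transitivity (\sum_(i < n) \sum_(j < n) (a ^+ (2 ^ i) * b ^+ (2 ^ j) *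
    \sum_(x : finvect_type L) (x : L) ^+ e i j)).
  under eq_bigr => x _ do rewrite mulr_suml mulr_suml.
  rewrite exchange_big; apply: eq_bigr => i _ /=.
  under eq_bigr => x _ do rewrite mulr_sumr mulr_suml.
  rewrite exchange_big; apply: eq_bigr => j _ /=.
  rewrite mulr_sumr; apply: eq_bigr => x _; rewrite !exprMn /e.
  have [->|x0] := eqVneq (x : L) 0.
    by rewrite invr0 mulr0 expr0n (gtn_eqF (e0 i j)) mulr0.
  apply: (mulIf x0); rewrite mulfVK // -[RHS]mulrA -exprSr eS.
  by rewrite exprD mulrACA.
have le2 (i : 'I_n) : (2 ^ i <= 2 ^ n.-1)%N.
  by rewrite leq_exp2l // -ltnS prednK.
have lt2 (i : 'I_n) : i != Ordinal ltn1 -> (2 ^ i < 2 ^ n.-1)%N.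
  by move=> ni; rewrite ltn_exp2l // ltn_neqAle ni -ltnS prednK /=.
have E2 : (2 ^ n)%N = (2 ^ n.-1 + 2 ^ n.-1)%N.
  by rewrite addnn -mul2n -expnS prednK.
rewrite (bigD1 (Ordinal ltn1)) //= [X in _ + X]big1 ?addr0 => [|i ni].
  rewrite (bigD1 (Ordinal ltn1)) //= [X in _ + X]big1 ?addr0 => [|j nj].
    by rewrite /e -E2 sum_expr_max mulr1 exprMn.
  rewrite sum_expr_lt ?mulr0 // e0 ltn_predRL eS.
  by rewrite -/n E2 ltn_add2l lt2.
rewrite big1 // => j _.
rewrite sum_expr_lt ?mulr0 // e0 ltn_predRL eS.
by rewrite -/n E2 -addSn leq_add ?lt2.
Qed.

(** Traces are 0 or 1, so the first two factors move inside the third trace; squaring under that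
    trace then removes the exponent 2^(n-1). *)
Lemma sum_trace2_triple {L : fieldExtType 'F_2} (a b c : L) :
  \sum_(x : finvect_type L)
    trace2 (a * x : L) * trace2 (b * x : L) * trace2 (c * (x : L)^-1)
  = trace2 (c ^+ 2 * (a * b)).
Proof.
transitivity (trace2 (c * (a * b) ^+ (2 ^ (\dim {:L}).-1))).
  rewrite -sum_trace2_inv mulr_sumr trace2_sum; apply: eq_bigr => x _.
  by rewrite mulrCA -[in RHS]mulrA !trace2_mul_trace2 mulrA.
rewrite -trace2_sqr exprMn -exprM -expnSr prednK ?dimf_gt0 //.
by rewrite expr2n_dim.
Qed.

(* If the trace vanished, [sum_trace2_inv] at [a = b = 1] would read [0 = 1]. *)
Lemma trace2_nondegenerate {L : fieldExtType 'F_2} (x : L) :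
  x != 0 -> exists w, trace2 (w * x) = 1.
Proof.
move=> x0; have [y] : exists y : finvect_type L, trace2 (y : L) != 0.
  apply/existsP; apply: contraT => /existsPn t0.
  have := sum_trace2_inv (L := L) 1 1.
  rewrite big1 => [|z _]; last first.
    by have := t0 z; rewrite negbK mul1r => /eqP ->; rewrite !mul0r.
  by rewrite mul1r expr1n => /esym/eqP; rewrite oner_eq0.
by exists (y / x : L); rewrite divfK // trace2_eq.
Qed.

(** If tr(w z) = 1, exactly one of tr(w y) and tr(w (y + z)) is 1, so f is the sum of [g] and its
    translate, whose total sums cancel. *)
Lemma sum_periodic {L : fieldExtType 'F_2} (f : L -> L) (z : L) :
  z != 0 -> (forall y, f (y + z) = f y) -> \sum_(y : finvect_type L) f y = 0.
Proof.
move=> /trace2_nondegenerate[w tw] fz.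
have zI : injective (fun y : finvect_type L => y + z : finvect_type L).
  exact: addIr.
pose g (y : L) := f y * trace2 (w * y).
have -> : \sum_(y : finvect_type L) f y =
          \sum_(y : finvect_type L) (g y + g (y + z)).
  apply: eq_bigr => y _; rewrite /g fz -mulrDr [w * (_ + _)]mulrDr trace2D tw.
  by rewrite addrA addxx add0r mulr1.
by rewrite big_split /= [X in X + _](reindex_inj zI) addxx.
Qed.

(** * The trace pairing, orthogonals and adjoints *)

Fact trace2_is_linear {L : fieldExtType 'F_2} : linear (@trace2 L).
Proof. by move=> k x y; rewrite trace2D trace2Z. Qed.

HB.instance Definition _ (L : fieldExtType 'F_2) :=
  GRing.isSemilinear.Build 'F_2 L L _ (@trace2 L)
    (GRing.semilinear_linear trace2_is_linear).

Lemma trace2_mem1 {L : fieldExtType 'F_2} (x : L) : trace2 x \in 1%VS.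
Proof.
have [->|/trace2_eq ->] := eqVneq (trace2 x) 0; first exact: mem0v.
exact: mem1v.
Qed.

(** The codomain is the line F_2 inside [L], so that the space of functionals has the dimension of
    [V]. *)
Definition pairing {L : fieldExtType 'F_2} {V : vectType 'F_2} (g : 'Hom(V, L))
    (b : L) : 'Hom(V, subvs_of (1%VS : {vspace L})) :=
  (linfun (vsproj 1%VS) \o (linfun (@trace2 L) \o (amull b \o g)))%VF.

Lemma pairingE {L : fieldExtType 'F_2} {V : vectType 'F_2} (g : 'Hom(V, L)) b v :
  vsval (pairing g b v) = trace2 (b * g v).
Proof. by rewrite !comp_lfunE !lfunE /= vsprojK ?lfunE ?trace2_mem1. Qed.

Lemma pairing_is_linear {L : fieldExtType 'F_2} {V : vectType 'F_2}
  (g : 'Hom(V, L)) : linear (pairing g).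
Proof.
by move=> k x y; rewrite /pairing linearP !(comp_lfunDl, comp_lfunDr)
   -!(comp_lfunZl, comp_lfunZr).
Qed.

HB.instance Definition _ (L : fieldExtType 'F_2) (V : vectType 'F_2)
    (g : 'Hom(V, L)) :=
  GRing.isSemilinear.Build 'F_2 L 'Hom(V, subvs_of (1%VS : {vspace L})) _
    (pairing g) (GRing.semilinear_linear (pairing_is_linear g)).

Lemma lker_pairingP {L : fieldExtType 'F_2} {V : vectType 'F_2} (g : 'Hom(V, L))
    (b : L) :
  reflect (forall v, trace2 (b * g v) = 0) (b \in lker (linfun (pairing g))).
Proof.
rewrite memv_ker lfunE /=; apply: (iffP eqP) => [b0 v|b0].
  by rewrite -pairingE b0 zero_lfunE linear0.
by apply/lfunP=> v; apply: subvs_inj; rewrite pairingE b0 zero_lfunE linear0.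
Qed.

Lemma dim_pairing {L : fieldExtType 'F_2} {V : vectType 'F_2} :
  \dim {: 'Hom(V, subvs_of (1%VS : {vspace L}))} = \dim {:V}.
Proof.
rewrite !dimvf -[RHS]muln1; congr (_ * _)%N.
exact: (dimv1 L).
Qed.

Lemma dim_lker_pairing {L : fieldExtType 'F_2} {V : vectType 'F_2}
    (g : 'Hom(V, L)) :
  (\dim {:L} <= \dim (lker (linfun (pairing g))) + \dim {:V})%N.
Proof.
rewrite -(limg_ker_dim (linfun (pairing g)) {:L}) capfv leq_add2l.
by rewrite -(dim_pairing (L := L)) dimvS ?subvf.
Qed.

HB.lock Definition perp (L : fieldExtType 'F_2) (U : {vspace L}) : {vspace L} :=
  lker (linfun (pairing (linfun vsval : 'Hom(subvs_of U, L)))).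
Arguments perp {L} U.

Lemma perpP {L : fieldExtType 'F_2} (U : {vspace L}) (a : L) :
  reflect (forall u, u \in U -> trace2 (a * u) = 0) (a \in perp U).
Proof.
rewrite perp.unlock; apply: (iffP (lker_pairingP _ _)) => [aU u uU | aU u].
  by have := aU (Subvs uU); rewrite lfunE.
by rewrite lfunE aU ?subvsP.
Qed.

Lemma perpf {L : fieldExtType 'F_2} : perp {:L} = 0%VS.
Proof.
apply/eqP; rewrite -subv0; apply/subvP=> a /perpP aL; rewrite memv0.
apply: contraT => /trace2_nondegenerate[w] /eqP.
by rewrite mulrC aL ?memvf // eq_sym oner_eq0.
Qed.

Lemma dim_perp {L : fieldExtType 'F_2} (U : {vspace L}) :
  (\dim (perp U) + \dim U)%N = \dim {:L}.
Proof.
have ge (W : {vspace L}) : (\dim {:L} <= \dim (perp W) + \dim W)%N.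
  rewrite perp.unlock.
  have := dim_lker_pairing (linfun vsval : 'Hom(subvs_of W, L)).
  by rewrite (dimvf (subvs_of W)).
(* The inequality for the complement of U gives the upper bound, because the
   orthogonals of U and of its complement meet trivially. *)
have cap0 : (perp U :&: perp U^C = 0)%VS.
  apply/eqP; rewrite -subv0 -perpf.
  apply/subvP=> a; rewrite memv_cap => /andP[/perpP aU /perpP aUC].
  apply/perpP => x _; have : x \in (U + U^C)%VS by rewrite addv_complf memvf.
  case/memv_addP=> u uU [v vU ->].
  by rewrite mulrDr trace2D aU // aUC // addr0.
apply/eqP; rewrite eqn_leq ge andbT.
have := ge U^C%VS; rewrite dimv_compl.
have := dimvS (subvf (perp U + perp U^C)); rewrite dimv_disjoint_sum //.
have := dimvS (subvf U).
lia.
Qed.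

Definition adjoint {L : fieldExtType 'F_2} (g h : 'End(L)) : Prop :=
  forall b x, trace2 (b * g x) = trace2 (h b * x).

(** Nondegeneracy and equal dimensions make [p] an isomorphism onto the functionals; its inverse
    represents x -> tr(b g(x)). *)
Lemma adjoint_exists {L : fieldExtType 'F_2} (g : 'End(L)) :
  exists h : 'End(L), adjoint g h.
Proof.
set p := linfun (pairing (\1 : 'End(L))).
have kp : lker p = 0%VS.
  apply/eqP; rewrite -subv0; apply/subvP=> a /lker_pairingP aL; rewrite memv0.
  apply: contraT => /trace2_nondegenerate[w] /eqP.
  by have := aL w; rewrite id_lfunE mulrC => ->; rewrite eq_sym oner_eq0.
have limp : limg p = fullv.
  apply/eqP; rewrite eqEdim subvf /= (dim_pairing (L := L)).
  by rewrite -[X in (X <= _)%N](limg_ker_dim p) kp capv0 dimv0.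
exists (p^-1 \o linfun (pairing g))%VF => b x; rewrite comp_lfunE lfunE /=.
rewrite -(pairingE g).
have pK : p (p^-1%VF (pairing g b)) = pairing g b.
  by rewrite limg_lfunVK ?limp ?memvf.
by rewrite -{1}pK lfunE /= pairingE id_lfunE.
Qed.

Lemma lker_adjoint {L : fieldExtType 'F_2} (g h : 'End(L)) :
  adjoint g h -> lker h = perp (limg g).
Proof.
move=> gh; apply/vspaceP=> a; apply/idP/idP.
  rewrite memv_ker => /eqP ag; apply/perpP => _ /memv_imgP[u _ ->].
  by rewrite gh ag mul0r trace2_0.
move/perpP=> ag; rewrite memv_ker.
apply: contraT => /trace2_nondegenerate[w].
by rewrite mulrC -gh ag ?memv_img ?memvf // => /esym/eqP; rewrite oner_eq0.
Qed.

(** * Trace identities for a permutation *)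

(** Some nonzero vector is orthogonal to a, b and c, and it is a period of the summand. *)
Lemma sum_trace2_prod3 {L : fieldExtType 'F_2} (a b c : L) :
  (3 < \dim {:L})%N ->
  \sum_(x : finvect_type L)
    trace2 (a * x : L) * trace2 (b * x : L) * trace2 (c * x : L) = 0.
Proof.
move=> n3; pose U := <<[:: a; b; c]>>%VS.
have: perp U != 0%VS.
  rewrite -dimv_eq0 -lt0n -(ltn_add2r (\dim U)) dim_perp add0n.
  by apply: leq_ltn_trans n3; exact: (dim_span [:: a; b; c]).
rewrite -vpick0 => /sum_periodic; apply => y.
have /perpP zU := memv_pick (perp U).
have inv u : u \in [:: a; b; c] ->
    trace2 (u * (y + vpick (perp U))) = trace2 (u * y).
  by move=> uU; rewrite mulrDr trace2D [u * vpick _]mulrC zU ?addr0 // memv_span.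
by rewrite !inv // !inE eqxx ?orbT.
Qed.

Lemma bijective_inv_plus_lin_trace2 {L : fieldExtType 'F_2}
    (L1 L2 M1 M2 : 'End(L)) (u v b : L) :
  (3 < \dim {:L})%N -> adjoint L1 M1 -> adjoint L2 M2 ->
  bijective (inv_plus_lin L1 L2) -> M2 u = 0 -> M2 v = 0 ->
  trace2 (M2 b ^+ 2 * (M1 u * M1 v)) = 0.
Proof.
move=> n3 adj1 adj2 bijF u0 v0.
(* After inversion, the factors of u and v involve x only, and that of b splits into a part in x and
   a part in x^-1. *)
pose h (x : finvect_type L) : finvect_type L := inv_plus_lin L1 L2 (x : L)^-1.
have hI : injective h.
  by move=> x y /(bij_inj bijF) /(@invr_inj L).
have := sum_trace2_prod3 u v b n3; rewrite (reindex_inj hI) /=.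
have E w x : trace2 (w * inv_plus_lin L1 L2 x^-1) =
    trace2 (M1 w * x) + trace2 (M2 w * x^-1).
  by rewrite /inv_plus_lin invrK mulrDr trace2D adj1 adj2.
under eq_bigr => x _ do rewrite !E u0 v0 !mul0r trace2_0 !addr0 mulrDr.
by rewrite big_split /= sum_trace2_prod3 // add0r sum_trace2_triple.
Qed.

(** * Subspaces stable under q^2 a *)

(** The map q -> q^2 a' is injective on the finite set B, hence onto; b = q^2 a' turns (a / a') b
    into q^2 a. *)
Lemma mul_stable_ratio {L : fieldExtType 'F_2} (A B : {vspace L}) :
  (forall q a, q \in B -> a \in A -> q ^+ 2 * a \in B) ->
  forall a a' b, a \in A -> a' \in A -> a' != 0 -> b \in B -> a / a' * b \in B.
Proof.
move=> BA a a' b aA a'A a'0 bB.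
pose f (q : finvect_type L) : finvect_type L := (q : L) ^+ 2 * a'.
have fI : injective f.
  move=> x y /(mulIf a'0) /eqP; rewrite -subr_eq0 subr_sqr mulf_eq0.
  by rewrite -[X in _ || (_ + X == _)](oppr_pchar2 (pchar2 L)) orbb subr_eq0 => /eqP.
pose D := [set x : finvect_type L | (x : L) \in B].
have : (b : finvect_type L) \in D by rewrite inE.
have -> : D = f @: D.
  apply/esym/eqP; rewrite eqEcard card_imset // leqnn andbT.
  by apply/subsetP=> _ /imsetP[x xD ->]; move: xD; rewrite !inE => /BA; apply.
case/imsetP=> q; rewrite inE => qB ->.
by rewrite /f mulrC -mulrA [a' * _]mulrC divfK // BA.
Qed.

Lemma dvdn_dim_adjoin {L : fieldExtType 'F_2} (B : {vspace L}) (m : L) :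
  (forall b, b \in B -> m * b \in B) -> (\dim <<1; m>> %| \dim B)%N.
Proof.
move=> mB; apply: (field_module_dimS (F := <<1; m>>%AS)).
apply/prodvP => x y /Fadjoin1_polyP[p ->] yB.
rewrite horner_coef mulr_suml memv_suml // => i _.
rewrite coef_map /= mulr_algl -scalerAl memvZ //.
by elim: (i : nat) => [|j IH]; rewrite ?mul1r // exprS -mulrA mB.
Qed.

(** The degree of F_2(a / a') divides both dim B and n, so a / a' lies in F_2. *)
Lemma dim_le1_of_stable {L : fieldExtType 'F_2} (A B : {vspace L}) :
  (forall q a, q \in B -> a \in A -> q ^+ 2 * a \in B) ->
  coprime (\dim B) (\dim {:L}) -> (\dim A <= 1)%N.
Proof.
move=> BA co; have [->|] := eqVneq A 0%VS; first by rewrite dimv0.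
rewrite -vpick0; set a' := vpick A => a'0.
have a'A : a' \in A by exact: memv_pick.
rewrite -[X in (_ <= X)%N]/(nat_of_bool true) -a'0 -(dim_vline a') dimvS //.
apply/subvP => a aA; have := dvdn_dim_adjoin B (a / a').
move=> /(_ (fun b => mul_stable_ratio _ _ BA _ _ b aA a'A a'0)) d1.
have d2 := field_dimS (subvf <<1; a / a'>>%AS).
have := dvdn_gcd (\dim <<1; a / a'>>) (\dim B) (\dim {:L}).
rewrite d1 d2 (eqnP co) dvdn1 => /eqP dim1.
have : a / a' \in 1%VS.
  suff -> : 1%VS = <<1; a / a'>>%VS by exact: memv_adjoin.
  by apply/eqP; rewrite eqEdim (subv_adjoin 1%AS) dim1 dimv1.
case/vlineP=> k /(canRL (divfK a'0)) ->.
by rewrite -scalerAl mul1r memvZ ?memv_line.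
Qed.

Lemma inv_mem_of_stable {L : fieldExtType 'F_2} (A B : {vspace L}) (c : L) :
  (forall q a, q \in B -> a \in A -> q ^+ 2 * a \in B) ->
  \dim A = \dim B -> c \in B -> c != 0 -> forall a, a \in A -> a^-1 \in B.
Proof.
move=> BA dAB cB c0 a aA.
have c2 : c ^+ 2 != 0 by rewrite expf_neq0.
have defB : (amull (c ^+ 2) @: A)%VS = B.
  apply/eqP; rewrite eqEdim; apply/andP; split.
    by apply/subvP=> _ /memv_imgP[x xA ->]; rewrite lfunE BA.
  rewrite limg_dim_eq ?dAB //; apply/eqP; rewrite -subv0.
  by rewrite (eqP (lker0_amull _)) ?unitfE // capv0.
have memA x : c ^+ 2 * x \in B -> x \in A.
  by rewrite -defB => /memv_imgP[y yA]; rewrite lfunE => /(mulfI c2) ->.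
have AA x y : x \in A -> y \in A -> c ^+ 2 * x ^+ 2 * y \in A.
  move=> xA yA; apply: memA.
  suff -> : c ^+ 2 * (c ^+ 2 * x ^+ 2 * y) = (c ^+ 2 * x) ^+ 2 * y.
    by rewrite BA // BA.
  by rewrite exprMn [(c ^+ 2) ^+ 2]expr2 !mulrA.
have cA : c^-1 \in A by apply: memA; rewrite expr2 mulfK.
(* The set c A contains 1 and, with s and t, also s^2 t; halving e therefore reaches every power of
   c a. *)
have P e : c^-1 * (c * a) ^+ e \in A.
  elim/ltn_ind: e => e IH; case: (posnP e) => [->|e0].
    by rewrite expr0 mulr1.
  have {}IH : c^-1 * (c * a) ^+ e./2 \in A by apply: IH; lia.
  rewrite -(odd_double_half e) -muln2; case: (odd e).
    suff -> : c^-1 * (c * a) ^+ (1 + e./2 * 2) =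
      c ^+ 2 * (c^-1 * (c * a) ^+ e./2) ^+ 2 * a by exact: AA.
    by rewrite add1n exprS exprM; field.
  suff -> : c^-1 * (c * a) ^+ (0 + e./2 * 2) =
      c ^+ 2 * (c^-1 * (c * a) ^+ e./2) ^+ 2 * c^-1 by exact: AA.
  by rewrite add0n exprM; field.
have [->|a0] := eqVneq a 0; first by rewrite invr0 mem0v.
have w0 : c * a != 0 by rewrite mulf_neq0.
have wV : (c * a) ^+ (2 ^ \dim {:L} - 2) = (c * a)^-1.
  apply: (mulIf w0); apply: (mulIf w0); rewrite mulVf // mul1r.
  by rewrite -!exprSr -[RHS]expr2n_dim; congr (_ ^+ _); have := exp2_gt1_dim L; lia.
have := P (2 ^ \dim {:L} - 2)%N; rewrite wV => /(BA c _ cB).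
by rewrite invfM !mulrA expr2 mulfK // divff // mul1r.
Qed.

(** Proved by counting points, since it is applied to the nonlinear F. *)
Lemma dim_le_of_injective {L : fieldExtType 'F_2} (A V : {vspace L})
    (f : L -> L) :
  injective f -> (forall x, x \in A -> f x \in V) -> (\dim A <= \dim V)%N.
Proof.
move=> fI fAV.
have cardE (W : {vspace L}) :
    #|[set x : finvect_type L | (x : L) \in W]| = (2 ^ \dim W)%N.
  have := card_vspace (W : {vspace finvect_type L}); rewrite card_Fp // => <-.
  by apply: eq_card => x; rewrite inE.
rewrite -(@leq_exp2l 2) // -!cardE.
pose g (x : finvect_type L) : finvect_type L := f x.
rewrite -(card_imset _ (fI : injective g)) subset_leq_card //.
by apply/subsetP=> _ /imsetP[x xA ->]; move: xA; rewrite !inE; apply: fAV.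
Qed.

Lemma dim_lker_limg {L : fieldExtType 'F_2} (g : 'End(L)) :
  (\dim (lker g) + \dim (limg g))%N = \dim {:L}.
Proof. by have := limg_ker_dim g {:L}; rewrite capfv. Qed.

Lemma bijective_lker0 {L : fieldExtType 'F_2} (g : 'End(L)) :
  lker g == 0%VS -> bijective g.
Proof.
by move=> g0; exists (g^-1)%VF; [exact: lker0_lfunK | exact: lker0_lfunVK].
Qed.

(** For k + l even the bound forces l = k; for k + l = 3, 5 mod 8 it forces l = k + 1; for 1, 7 mod
    8 it contradicts k <= l. *)
Lemma kerdim_bound_lt (k l : nat) :
  (kerdim_bound (k + l) < k)%N -> (k <= l)%N -> l = k \/ l = k.+1.
Proof.
rewrite /kerdim_bound !inE; move En: (k + l)%N => n.
by case: ifP => [|n1]; last case: ifP; lia.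
Qed.

(** * Excluding a large kernel of [L2] *)

Lemma not_bijective_inv_plus_lin {L : fieldExtType 'F_2} (L1 L2 : 'End(L)) :
  (4 < \dim {:L})%N -> ~ bijective L1 ->
  (kerdim_bound (\dim {:L}) < \dim (lker L2))%N ->
  ~ bijective (inv_plus_lin L1 L2).
Proof.
move=> n5 nbij1 kL2 bijF.
have [M1 adj1] := adjoint_exists L1; have [M2 adj2] := adjoint_exists L2.
pose U := lker M2; pose B := limg M2; pose A := (M1 @: U)%VS.
have traceF b x : trace2 (b * inv_plus_lin L1 L2 x) =
    trace2 (M1 b * x^-1) + trace2 (M2 b * x).
  by rewrite mulrDr trace2D adj1 adj2.
(* Such a b is orthogonal to every value of F, and F is onto. *)
have adj0 b : M1 b = 0 -> M2 b = 0 -> b = 0.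
  move=> b1 b2; apply/eqP; apply: contraT => /trace2_nondegenerate[w].
  case: bijF => G _ /(_ w) <-.
  by rewrite mulrC traceF b1 b2 !mul0r trace2_0 addr0 => /esym/eqP; rewrite oner_eq0.
have dimU : \dim U = \dim (lker L2).
  have := dim_perp (limg L2); rewrite -(lker_adjoint _ _ adj2).
  by rewrite -(dim_lker_limg L2) => /addIn.
have dimUB : (\dim U + \dim B)%N = \dim {:L}.
  exact: dim_lker_limg.
have dimA : \dim A = \dim U.
  apply: limg_dim_eq; apply/eqP; rewrite -subv0; apply/subvP=> b.
  case/memv_capP=> bU; rewrite memv_ker => /eqP b1.
  by move: bU; rewrite memv_ker => /eqP b2; rewrite (adj0 b b1 b2) mem0v.
have trBAA q a a' : q \in B -> a \in A -> a' \in A -> trace2 (q ^+ 2 * (a * a')) = 0.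
  case/memv_imgP=> b _ -> /memv_imgP[u uU ->] /memv_imgP[v vU ->].
  apply: bijective_inv_plus_lin_trace2 adj1 adj2 bijF _ _; first exact: ltnW.
    by apply/eqP; rewrite -memv_ker.
  by apply/eqP; rewrite -memv_ker.
have BperpA : B = perp A.
  apply/eqP; rewrite eqEdim; apply/andP; split.
    apply/subvP=> q qB; apply/perpP=> a aA.
    by rewrite -trace2_sqr exprMn [a ^+ 2]expr2 trBAA.
  by rewrite -(leq_add2r (\dim A)) dim_perp dimA addnC dimUB.
have BA q a : q \in B -> a \in A -> q ^+ 2 * a \in B.
  by move=> qB aA; rewrite BperpA; apply/perpP=> a' a'A; rewrite -mulrA trBAA.
(* The image of [L1] is proper, and the kernel of [M1] is its orthogonal. *)
have [b0 b0n b01] : exists2 b, b != 0 & M1 b = 0.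
  exists (vpick (lker M1)); last first.
    by apply/eqP; rewrite -memv_ker memv_pick.
  rewrite vpick0 (lker_adjoint _ _ adj1) -dimv_eq0.
  apply/negP=> /eqP p0; apply: nbij1.
  apply: bijective_lker0; rewrite -dimv_eq0.
  have := dim_lker_limg L1; rewrite -(dim_perp (limg L1)) p0 add0n.
  by move/eqP; rewrite -[X in _ == X]add0n eqn_add2r.
pose c := M2 b0.
have c0 : c != 0 by apply: contraNneq b0n => /(adj0 _ b01) ->.
have cB : c \in B by rewrite memv_img ?memvf.
have leAB : (\dim A <= \dim B)%N.
  apply: (@dim_le_of_injective _ _ _ (fun x => c ^+ 2 * x)) => [|a aA].
    by apply: mulfI; rewrite expf_neq0.
  exact: BA.
have kA : (kerdim_bound (\dim {:L}) < \dim A)%N by rewrite dimA dimU.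
have dimAB : (\dim A + \dim B)%N = \dim {:L} by rewrite dimA.
have [n2k|n2k1] : \dim B = \dim A \/ \dim B = (\dim A).+1.
- by apply: kerdim_bound_lt; [rewrite dimAB | exact: leAB].
- have invA := inv_mem_of_stable _ _ _ BA (esym n2k) cB c0.
  (* For x in A, tr(b0 F(x)) = tr(c x) and tr(u F(x)) = tr(M1(u) x^-1); both vanish because c and
     x^-1 lie in B, the orthogonal of A. *)
  have : (\dim A <= \dim (perp (U + <[b0]>)))%N.
    apply: (dim_le_of_injective _ _ _ (bij_inj bijF)) => x xA.
    apply/perpP=> _ /memv_addP[u uU [_ /vlineP[l ->] ->]].
    have xB := invA x xA; move: (cB) xB; rewrite BperpA => /perpP cA /perpP xB.
    rewrite mulrC mulrDl trace2D -scalerAl trace2Z !traceF b01 mul0r trace2_0 add0r.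
    rewrite (cA x xA) scaler0 addr0 mulrC (xB (M1 u) (memv_img _ uU)) add0r.
    by move: uU; rewrite memv_ker => /eqP ->; rewrite mul0r trace2_0.
  (* As c <> 0, b0 is outside U, so the orthogonal has dimension n - (dim A + 1) = dim A - 1. *)
  have : (U :&: <[b0]> = 0)%VS.
    apply/eqP; rewrite -subv0; apply/subvP=> x; rewrite memv0.
    case/memv_capP=> xU /vlineP[l xE]; move: xU; rewrite memv_ker xE linearZ /=.
    by rewrite !scaler_eq0 (negPf c0) (negPf b0n).
  have := dim_perp (U + <[b0]>); rewrite -dimAB n2k => dimV.
  move=> /dimv_disjoint_sum; rewrite -dimA dim_vline b0n => dimS.
  by move: dimV; rewrite dimS; lia.
(* Here n = 2 dim A + 1 is coprime to dim A + 1, and dim A <= 1 would give n <= 3. *)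
- have : (\dim A <= 1)%N.
    apply: (dim_le1_of_stable _ _ BA); rewrite -dimAB n2k1.
    by rewrite /coprime gcdnDr -/(coprime _ _) coprimeSn.
  by move: n5; rewrite -dimAB n2k1; lia.
Qed.

Theorem theorem6 (n : nat) (hn : (5 <= n)%N)
    (L : fieldExtType 'F_2) (hL : \dim {:L} = n)
    (L1 L2 : 'End(L))
    (L1_neq0 : L1 <> 0) (L2_neq0 : L2 <> 0)
    (L1_nbij : ~ bijective L1) (L2_nbij : ~ bijective L2)
    (hker : (kerdim_bound n < maxn (\dim (lker L1)) (\dim (lker L2)))%N) :
  ~ bijective (inv_plus_lin L1 L2).
Proof.
move: hn hker; rewrite -hL leq_max => n5 /orP[k1|k2] bijF; last first.
  exact: not_bijective_inv_plus_lin n5 L1_nbij k2 bijF.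
apply: (not_bijective_inv_plus_lin _ _ n5 L2_nbij k1).
apply: (eq_bij (f := inv_plus_lin L1 L2 \o GRing.inv)) => [|x].
  by apply: bij_comp => //; exists GRing.inv; exact: invrK.
by rewrite /= /inv_plus_lin invrK addrC.
Qed.
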